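(* Let $M$ be a left $R$-module which is a self-progenerator in $\sigma[M]$. Assume $M$ is strongly harmonic and $\Lambda^{fi}(M)$ is compact. Then $\Psi(M)\cong\mathcal{O}(Max^{fi}(M))$ as frames.
   Context: $R$ is an associative ring with identity; modules are unital left $R$-modules. A submodule $N\leq M$ is fully invariant if $f(N)\subseteq N$ for all $f\in\mathrm{End}_R(M)$; $\Lambda^{fi}(M)$ is the complete lattice of fully invariant submodules of $M$ ordered by inclusion, and $Max^{fi}(M)$ is the set of its coatoms (maximal proper elements), with the topology $\mathcal{O}(Max^{fi}(M))$ whose open sets are $\{\mathcal{M}\in Max^{fi}(M)\mid K\nleq\mathcal{M}\}$, $K\in\Lambda^{fi}(M)$; this topology is regarded as a frame. $\sigma[M]$ is the full subcategory of $R$-Mod of all modules that embed in a quotient of some direct sum $M^{(X)}$. $M$ is $N$-projective if for every epimorphism $\rho\colon N\to X$ and every homomorphism $\alpha\colon M\to X$ there is $\beta\colon M\to N$ with $\rho\beta=\alpha$; $M$ is projective in $\sigma[M]$ if it is $N$-projective for every $N\in\sigma[M]$. $M$ is a self-progenerator in $\sigma[M]$ if it is projective in $\sigma[M]$ and every submodule of $M$ is $M$-generated (a quotient of some $M^{(X)}$). For $N,L\leq M$ put $N_ML=\sum\{f(N)\mid f\in\mathrm{Hom}_R(M,L)\}$. For $K\leq M$ put $\mathrm{Ann}_M(K)=\bigcap\{\ker f\mid f\in\mathrm{Hom}_R(M,K)\}$. $M$ is strongly harmonic if for every two distinct $N,L\in Max^{fi}(M)$ there exist $N',L'\in\Lambda^{fi}(M)$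 with $L'\nleq L$, $N'\nleq N$ and $L'_MN'=0$. $\Lambda^{fi}(M)$ is compact if whenever $M=\sum_{i\in I}N_i$ with all $N_i\in\Lambda^{fi}(M)$, there is a finite $F\subseteq I$ with $M=\sum_{i\in F}N_i$. $\Psi(M)=\{N\in\Lambda^{fi}(M)\mid N+\mathrm{Ann}_M(Rn)=M\text{ for all }n\in N\}$, ordered by inclusion; it is a frame with joins given by sums and finite meets by intersections. *)

(* Defs.v *)
From HB Require Import structures.
From mathcomp Require Import all_boot all_order all_algebra.
From mathcomp Require Import boolp classical_sets functions cardinality.

Set Implicit Arguments.
Unset Strict Implicit.
Unset Printing Implicit Defensive.

Import Order.TTheory GRing.Theory.
Local Open Scope classical_set_scope.
Local Open Scope ring_scope.

(* The base ring is a [pzRingType]: associative with identity, not assumed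
   commutative, and possibly zero. *)

(* M^(X): functions X -> M with finite support, as a submodule of the product
   module X -> M. *)
Section DirectSum.
Variables (R : pzRingType) (M : lmodType R) (X : Type).

Definition finsupp_pred : {pred X -> M} :=
  fun f => `[< finite_set [set x | f x != 0] >].

Fact finsupp_submod_closed : submod_closed finsupp_pred.
Proof.
split=> [|a u v /asboolP fu /asboolP fv]; apply/asboolP.
  apply: (sub_finite_set _ (finite_set0 X)) => x /=.
  by rewrite eqxx.
have fuv : finite_set ([set x | u x != 0] `|` [set x | v x != 0]).
  by rewrite finite_setU.
apply: (sub_finite_set _ fuv) => x /= ne0.
have [ux0|] := eqVneq (u x) 0; last by left.
right; apply: contra_neq ne0 => vx0.
by rewrite !fctE ux0 vx0 scaler0 addr0.
Qed.

HB.instance Definition _ :=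
  GRing.isSubmodClosed.Build R (X -> M) finsupp_pred finsupp_submod_closed.

Record dsum := Dsum {dsum_val :> X -> M; _ : dsum_val \in finsupp_pred}.

HB.instance Definition _ := [isSub for dsum_val].
HB.instance Definition _ := [Choice of dsum by <:].
HB.instance Definition _ := [SubChoice_isSubLmodule of dsum by <:].

End DirectSum.

Section Modules.
Variable R : pzRingType.

Definition is_surj (A B : Type) (f : A -> B) := forall y, exists x, f x = y.

Definition in_sigma (M N : lmodType R) : Prop :=
  exists (X : Type) (Q : lmodType R)
         (p : {linear dsum M X -> Q}) (i : {linear N -> Q}),
    is_surj p /\ injective i.

Definition relatively_projective (M N : lmodType R) : Prop :=
  forall (Q : lmodType R) (rho : {linear N -> Q}) (alpha : {linear M -> Q}),
    is_surj rho -> exists beta : {linear M -> N}, rho \o beta =1 alpha.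

Definition projective_in_sigma (M : lmodType R) : Prop :=
  forall N : lmodType R, in_sigma M N -> relatively_projective M N.

End Modules.

Section Submodules.
Variables (R : pzRingType) (M : lmodType R).
Implicit Types N K L : set M.

Definition submodule N : Prop := submod_closed [in N].

(* An epimorphism M^(X) ->> N is given as a linear map into M with image N. *)
Definition self_progenerator : Prop :=
  projective_in_sigma M /\
  forall N, submodule N ->
    exists (X : Type) (g : {linear dsum M X -> M}), range g = N.

(* The sum of the submodules N i, i in D: finite sums of elements of their
   union (so the zero submodule when D is empty). *)
Definition sum_sub (I : Type) (D : set I) (N : I -> set M) : set M :=
  [set x | exists2 s : seq M,
     (forall y, y \in s -> (\bigcup_(i in D) N i) y) & x = \sum_(y <- s) y].

Definition add_sub N K : set M := [set x + y | x in N & y in K].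

(* For a submodule L of M, Hom_R(M, L) is identified with the endomorphisms
   of M with image in L. *)
Definition hom_into L : set {linear M -> M} := [set f | range f `<=` L].

(* N_M L *)
Definition mprod N L : set M :=
  sum_sub (hom_into L) (fun f : {linear M -> M} => f @` N).

Definition Ann K : set M :=
  \bigcap_(f in hom_into K) [set x | f x = 0].

Definition cyclic_sub (n : M) : set M := range (fun a : R => a *: n).

Definition fully_invariant : set (set M) :=
  [set N | submodule N /\ forall f : {linear M -> M}, f @` N `<=` N].

Definition max_fi : set (set M) :=
  [set N | [/\ fully_invariant N, N <> setT &
     forall K, fully_invariant K -> N `<=` K -> K = N \/ K = setT]].

(* Max^fi(M) is the type [set_type max_fi]. *)
Definition max_fi_open : set (set (set_type max_fi)) :=
  [set U | exists2 K, fully_invariant K &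
     U = [set P : set_type max_fi | ~ K `<=` val P]].

Definition strongly_harmonic : Prop :=
  forall N L, max_fi N -> max_fi L -> N <> L ->
    exists N' L', [/\ fully_invariant N', fully_invariant L',
      ~ L' `<=` L, ~ N' `<=` N & mprod L' N' = [set 0]].

Definition fi_compact : Prop :=
  forall (I : Type) (N : I -> set M),
    (forall i, fully_invariant (N i)) -> sum_sub setT N = setT ->
    exists2 F : set I, finite_set F & sum_sub F N = setT.

Definition Psi : set (set M) :=
  [set N | fully_invariant N /\
     forall n, N n -> add_sub N (Ann (cyclic_sub n)) = setT].

End Submodules.

Arguments self_progenerator {R} M.
Arguments strongly_harmonic {R} M.
Arguments fi_compact {R} M.
Arguments Psi {R} M.
Arguments max_fi {R} M.
Arguments max_fi_open {R} M.

(* A family of subsets of T, as a poset under inclusion. *)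
Definition incl_poset (T : Type) (F : set (set T)) : Type := set_type F.

HB.instance Definition _ (T : Type) (F : set (set T)) :=
  SubType.copy (incl_poset F) (set_type F).
HB.instance Definition _ (T : Type) (F : set (set T)) :=
  [Choice of incl_poset F by <:].
HB.instance Definition _ (T : Type) (F : set (set T)) :=
  [SubChoice_isSubPOrder of incl_poset F by <: with set_display].

(* Frames are taken order-theoretically: joins, finite meets and the top
   element (the meet of the empty set) are determined by the order. *)
Section Frames.

Definition is_frame d (P : porderType d) : Prop :=
  [/\ forall S : set P, exists s, supremums S s,
      forall A : set P, finite_set A -> exists m, infimums A m &
      forall (x : P) (S : set P) (s m : P),
        supremums S s -> infimums [set x; s] m ->
        supremums [set z | exists2 y, S y & infimums [set x; y] z] m].

Definition frame_hom d d' (P : porderType d) (Q : porderType d')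
    (f : P -> Q) : Prop :=
  (forall (S : set P) (s : P), supremums S s -> supremums (f @` S) (f s)) /\
  (forall (A : set P) (m : P),
     finite_set A -> infimums A m -> infimums (f @` A) (f m)).

Definition frame_isomorphic d d' (P : porderType d) (Q : porderType d') :
    Prop :=
  [/\ is_frame P, is_frame Q &
      exists (f : P -> Q) (g : Q -> P),
        [/\ cancel f g, cancel g f, frame_hom f & frame_hom g]].

End Frames.

(* Main.v *)
Require Import Defs.
From HB Require Import structures.
From mathcomp Require Import all_boot all_order all_algebra.
From mathcomp Require Import boolp classical_sets functions cardinality.

Set Implicit Arguments.
Unset Strict Implicit.
Unset Printing Implicit Defensive.

Import Order.TTheory GRing.Theory.
Local Open Scope classical_set_scope.
Local Open Scope ring_scope.

(** For a fully invariant submodule K, write D(K) for the open set of those P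
    in Max^fi(M) that do not contain K, and let the pure part of K be the set
    of x in M with K + Ann(Rx) = M.  The isomorphism sends N in Psi(M) to D(N);
    its inverse sends D(K) to the pure part of K.

    The pure part is a fully invariant submodule of K.  It is closed under
    addition and endomorphisms because Ann(Rx) /\ Ann(Ry) annihilates R h(x,y)
    for every linear h : M x M -> M ([Ann_cyclic_linear], where projectivity is
    used), and because K + A = K + B = M implies K + (A /\ B) = M
    ([add_sub_setI], where self-generation is used; it also makes the elements
    of Max^fi(M) prime).  It lies in K because Rx is generated by M
    ([pure_part_sub]).  So Psi(M) consists of the N that equal their pure part.

    By compactness every proper fully invariant submodule lies in a maximal one
    ([sub_max_fi]).  Hence K + Ann(Rx) = M says that no P in Max^fi(M) contains
    both K and Ann(Rx), which depends on K through D(K) only, and monotonically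
    ([pure_part_subset]).  For N in Psi(M) this recovers N from D(N), and N is
    contained in N' as soon as D(N) is contained in D(N').

    What remains is that K and its pure part have the same D
    ([max_open_pure_part]).  Let P not contain K.  The submodules K + Ann(B),
    for B fully invariant and not contained in P, form a directed family.  Its
    union lies in no maximal Q, since such a Q would contain K, hence differ
    from P, and strong harmonicity gives B not in P with Ann(B) not in Q.  So
    the union is M, and by compactness K + Ann(B) = M for a single B: then B is
    contained in the pure part of K, which is therefore not contained in P.

    Being a frame, and being a frame homomorphism, only depend on the order,
    so an order isomorphism with the frame of open sets is enough
    ([frame_isomorphic_of_mono_surj]). *)

(** * Cyclic submodules as modules, and lifting through them *)

Section CyclicModule.
Variables (R : pzRingType) (V : lmodType R) (v : V).

(** Membership in R v gets a named predicate so that the canonical module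
    structures of the subtype have a key to attach to. *)
Definition cyclic_pred : {pred V} := [in cyclic_sub v].

Fact cyclic_submod_closed : submod_closed cyclic_pred.
Proof.
split=> [|c _ _ /set_mem[a _ <-] /set_mem[b _ <-]]; apply/mem_set.
  by exists 0; rewrite ?scale0r.
by exists (c * a + b) => //; rewrite scalerDl scalerA.
Qed.

HB.instance Definition _ :=
  GRing.isSubmodClosed.Build R V cyclic_pred cyclic_submod_closed.

Record cyclic := Cyclic {cyclic_val :> V; _ : cyclic_val \in cyclic_pred}.

HB.instance Definition _ := [isSub for cyclic_val].
HB.instance Definition _ := [Choice of cyclic by <:].
HB.instance Definition _ := [SubChoice_isSubLmodule of cyclic by <:].

Section Corestriction.
Variables (U : lmodType R) (f : {linear U -> V}).
Hypothesis f_cyclic : forall u, f u \in cyclic_pred.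

Definition cyclic_corestr (u : U) : cyclic := Cyclic (f_cyclic u).

Fact cyclic_corestr_linear : linear cyclic_corestr.
Proof. by move=> a x y; apply/val_inj; rewrite /= linearP. Qed.

HB.instance Definition _ :=
  GRing.isLinear.Build R U cyclic _ cyclic_corestr cyclic_corestr_linear.

End Corestriction.
End CyclicModule.

Section Square.
Variables (R : pzRingType) (M : lmodType R).

(** This map presents M x M as a quotient of a direct sum of copies of M, which
    puts every submodule of M x M in sigma[M]. *)
Definition square_of_dsum (d : dsum M bool) : (M * M)%type := (d true, d false).

Fact square_of_dsum_linear : linear square_of_dsum.
Proof. by []. Qed.

HB.instance Definition _ :=
  GRing.isLinear.Build R (dsum M bool) (M * M)%type _ square_of_dsum
    square_of_dsum_linear.

Lemma square_of_dsum_surj : is_surj square_of_dsum.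
Proof.
move=> [x y].
have Hd : (fun b : bool => if b then x else y) \in @finsupp_pred _ M bool.
  exact/asboolP/finite_finset.
by exists (Dsum Hd).
Qed.

Lemma in_sigma_cyclic_square (w : (M * M)%type) : in_sigma M (cyclic w).
Proof.
exists bool, (M * M)%type, square_of_dsum, (\val : {linear cyclic w -> _}).
by split; [exact: square_of_dsum_surj | exact: val_inj].
Qed.

(** The map h sends R(x,y) onto R h(x,y), so by projectivity a map f from M to
    R h(x,y) lifts to a map b from M to R(x,y).  The components of b are maps
    from M to Rx and to Ry, hence vanish on z, and so does f = h o b. *)
Lemma Ann_cyclic_linear (h : {linear (M * M)%type -> M}) (x y : M) :
  projective_in_sigma M ->
  Ann (cyclic_sub x) `&` Ann (cyclic_sub y) `<=` Ann (cyclic_sub (h (x, y))).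
Proof.
move=> projM z [Ax Ay] f /= f_im; set w := (x, y).
have rho_im (u : cyclic w) : (h \o \val) u \in cyclic_pred (h w).
  case: u => u /= /set_mem[a _ <-]; apply/mem_set; exists a => //.
  by rewrite -linearZ.
have alpha_im m : f m \in cyclic_pred (h w) by apply/mem_set/f_im; exists m.
have rho_surj : is_surj (cyclic_corestr rho_im).
  case=> _ /[dup] /set_mem[a _ <-] Hv.
  have wa : a *: w \in cyclic_pred w by apply/mem_set; exists a.
  by exists (Cyclic wa); apply/val_inj; rewrite /= linearZ.
have [b bP] := projM _ (in_sigma_cyclic_square w) _
  (cyclic_corestr rho_im) (cyclic_corestr alpha_im) rho_surj.
have -> : f z = h (val (b z)) := congr1 val (esym (bP z)).
have b_im m : exists a : R, val (b m) = a *: w.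
  by case: (b m) => u /= /set_mem[a _ <-]; exists a.
have b1z : (fst \o (\val \o b)) z = 0.
  by apply: Ax => _ [m _ <-] /=; have [a ->] := b_im m; exists a.
have b2z : (snd \o (\val \o b)) z = 0.
  by apply: Ay => _ [m _ <-] /=; have [a ->] := b_im m; exists a.
by rewrite [val _]surjective_pairing [_.1]b1z [_.2]b2z -[RHS](linear0 h).
Qed.

End Square.

(** * Fully invariant submodules *)

Section FullyInvariant.
Variables (R : pzRingType) (M : lmodType R).
Implicit Types (N K A B P : set M) (x y : M).

Lemma submoduleP N :
  submodule N <-> N 0 /\ forall (a : R) x y, N x -> N y -> N (a *: x + y).
Proof.
split=> [[/set_mem N0 Nl]|[N0 Nl]]; split => //.
- by move=> a x y Nx Ny; apply/set_mem/Nl; exact: mem_set.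
- exact: mem_set.
- by move=> a x y /set_mem Nx /set_mem Ny; apply/mem_set/Nl.
Qed.

Lemma submodule0 N : submodule N -> N 0.
Proof. by case/submoduleP. Qed.

Lemma submoduleD N x y : submodule N -> N x -> N y -> N (x + y).
Proof. by case/submoduleP => _ Nl Nx Ny; rewrite -[x]scale1r; exact: Nl. Qed.

Lemma submoduleZ N (a : R) x : submodule N -> N x -> N (a *: x).
Proof. by case/submoduleP => N0 Nl Nx; rewrite -[_ *: _]addr0; exact: Nl. Qed.

Lemma submodule_sum N (s : seq M) :
  submodule N -> (forall y, y \in s -> N y) -> N (\sum_(y <- s) y).
Proof.
move=> subN sN; rewrite big_seq; elim/big_ind: _ => //; first exact: submodule0.
by move=> x y; exact: submoduleD.
Qed.

Lemma fully_invariantP N :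
  fully_invariant N <->
  submodule N /\ forall (f : {linear M -> M}) x, N x -> N (f x).
Proof.
split=> -[subN fN]; split=> // f; first by move=> x Nx; apply: (fN f); exists x.
by move=> _ [x Nx <-]; exact: fN.
Qed.

Lemma fully_invariant_setT : fully_invariant [set: M].
Proof. by apply/fully_invariantP; split=> //; apply/submoduleP. Qed.

Lemma fully_invariant_bigcap (I : Type) (D : set I) (N : I -> set M) :
  (forall i, D i -> fully_invariant (N i)) ->
  fully_invariant (\bigcap_(i in D) N i).
Proof.
move=> fiN; apply/fully_invariantP; split=> [|f x Nx i Di].
  apply/submoduleP; split=> [i Di|a x y Nx Ny i Di].
    by apply: submodule0; case: (fiN i Di).
  have /submoduleP[_ Nl] := (fiN i Di).1.
  by apply: Nl; [exact: Nx | exact: Ny].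
by have /fully_invariantP[_] := fiN i Di; apply; exact: Nx.
Qed.

Lemma fully_invariant_setI N K :
  fully_invariant N -> fully_invariant K -> fully_invariant (N `&` K).
Proof.
move=> fiN fiK; rewrite -bigcap2E; apply: fully_invariant_bigcap.
by move=> [|[|i]] _ //; exact: fully_invariant_setT.
Qed.

Lemma fully_invariant_add_sub N K :
  fully_invariant N -> fully_invariant K -> fully_invariant (add_sub N K).
Proof.
move=> /fully_invariantP[subN fN] /fully_invariantP[subK fK].
apply/fully_invariantP; split=> [|f _ [x Nx [y Ky <-]]].
  apply/submoduleP; split=> [|a _ _ [x Nx [y Ky <-]] [x' Nx' [y' Ky' <-]]].
    exists 0; first exact: submodule0.
    by exists 0; [exact: submodule0 | exact: addr0].
  move: subN subK => /submoduleP[_ Nl] /submoduleP[_ Kl].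
  exists (a *: x + x'); first exact: Nl.
  by exists (a *: y + y'); [exact: Kl | rewrite scalerDr addrACA].
by exists (f x); [exact: fN | exists (f y); [exact: fK | rewrite linearD]].
Qed.

Lemma sub_add_subl N K : submodule K -> N `<=` add_sub N K.
Proof.
by move=> /submodule0 K0 x Nx; exists x => //; exists 0; rewrite ?addr0.
Qed.

Lemma sub_add_subr N K : submodule N -> K `<=` add_sub N K.
Proof.
by move=> /submodule0 N0 x Kx; exists 0 => //; exists x; rewrite ?add0r.
Qed.

Lemma add_sub_min N K A :
  submodule A -> N `<=` A -> K `<=` A -> add_sub N K `<=` A.
Proof.
move=> subA NA KA _ [x Nx [y Ky <-]].
by apply: submoduleD => //; [exact: NA | exact: KA].
Qed.

Lemma fully_invariant_Ann K : fully_invariant (Ann K).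
Proof.
apply/fully_invariantP; split=> [|g x Ax f fK].
  apply/submoduleP; split=> [f _|a x y Ax Ay f fK]; first exact: linear0.
  by rewrite /= linearP (Ax f fK) (Ay f fK) scaler0 addr0.
by apply: (Ax (f \o g)) => _ [y _ <-]; apply: fK; exists (g y).
Qed.

Lemma subset_Ann N K : N `<=` K -> Ann K `<=` Ann N.
Proof. by move=> NK x Kx f fN; apply: Kx; exact: subset_trans NK. Qed.

Lemma directed_bigcup_fully_invariant (D : set (set M)) :
  D !=set0 -> D `<=` fully_invariant (M:=M) ->
  (forall A B, D A -> D B -> exists2 C, D C & A `|` B `<=` C) ->
  fully_invariant (\bigcup_(A in D) A).
Proof.
move=> [A0 DA0] Dfi Ddir; apply/fully_invariantP; split=> [|f x [A DA Ax]].
  apply/submoduleP; split=> [|a x y [A DA Ax] [B DB By]].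
    by exists A0 => //; apply: submodule0; case: (Dfi _ DA0).
  have [C DC ABC] := Ddir A B DA DB; exists C => //.
  have /submoduleP[_ Cl] := (Dfi C DC).1.
  by apply: Cl; apply: ABC; [left | right].
by exists A => //; have /fully_invariantP[_] := Dfi A DA; apply.
Qed.

(** A finite subfamily of a directed family is dominated by a member, so a
    finite sum of members can only be the whole of M if M is a member. *)
Lemma compact_directed (D : set (set M)) : fi_compact M ->
  D !=set0 -> D `<=` fully_invariant (M:=M) ->
  (forall A B, D A -> D B -> exists2 C, D C & A `|` B `<=` C) ->
  \bigcup_(A in D) A = setT -> D setT.
Proof.
move=> cM [A0 DA0] Dfi Ddir DT.
pose N (i : set_type D) := val i.
have ND i : D (N i) by exact/set_mem/(valP i).
have NT : sum_sub setT N = setT.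
  rewrite -subTset => x _; have : (\bigcup_(A in D) A) x by rewrite DT.
  move=> [A DA Ax]; exists [:: x]; last by rewrite big_seq1.
  move=> y; rewrite inE => /eqP ->.
  by exists (exist _ A (mem_set DA) : set_type D).
have [F finF FT] := cM _ N (fun i => Dfi _ (ND i)) NT.
have [s sF] : exists s : seq (set_type D), F = [set` s] by exact/finite_seqP.
have [C DC FC] : exists2 C, D C & forall i, i \in s -> N i `<=` C.
  elim: s {sF} => [|i s [C DC sC]]; first by exists A0.
  have [C' DC' CC'] := Ddir _ _ (ND i) DC; exists C' => // j.
  rewrite inE => /orP[/eqP->|js] x Nx; apply: CC'; first by left.
  by right; exact: sC js _ Nx.
suff <- : C = setT by [].
rewrite -subTset -FT sF => _ [t tP ->]; apply: submodule_sum.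
  by case: (Dfi C DC).
by move=> y /tP[i si]; exact: FC.
Qed.

(** Zorn's lemma applies because the union of a chain of proper fully invariant
    submodules is proper by [compact_directed]. *)
Lemma sub_max_fi N : fi_compact M -> fully_invariant N -> N <> setT ->
  exists2 P, max_fi M P & N `<=` P.
Proof.
move=> cM fiN NT.
(* The condition is put on the union of N and X so that the empty chain, whose
   union is empty, needs no upper bound other than N itself. *)
pose D := [set X | fully_invariant (N `|` X) /\ N `|` X <> setT].
have [F FD totF|X [[fiX XT] Xmax]] := @Zorn_bigcup M D; last first.
  exists (N `|` X); last exact: subsetUl.
  split=> // K fiK XK; have [KT|KT] := pselect (K = setT); [by right | left].
  have NK : N `|` K = K by apply/setUidPr/(subset_trans _ XK)/subsetUl.
  apply/seteqP; split=> // x Kx; apply: contrapT => Xx.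
  apply: (Xmax K); last by rewrite /D /= NK.
  split=> [y Xy|KX]; first by apply: XK; right.
  by apply: Xx; right; exact: KX.
have [->|F0] := eqVneq F set0; first by rewrite /D /= bigcup_set0 setU0.
have /set0P[X0 FX0] := F0.
pose G := [set N `|` X | X in F].
have FG : N `|` \bigcup_(X in F) X = \bigcup_(A in G) A.
  apply/seteqP; split=> [x [Nx|[X FX Xx]]|x [_ [X FX <-] [Nx|Xx]]].
  - by exists (N `|` X0); [exists X0 | left].
  - by exists (N `|` X); [exists X | right].
  - by left.
  - by right; exists X.
have G0 : G !=set0 by exists (N `|` X0); exists X0.
have Gfi : G `<=` fully_invariant (M:=M) by move=> _ [X /FD[fiX _] <-].
have Gdir A B : G A -> G B -> exists2 C, G C & A `|` B `<=` C.
  move=> [X FX <-] [Y FY <-]; have [XY|YX] := totF X Y FX FY.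
    exists (N `|` Y); first by exists Y.
    by rewrite setUACA setUid; apply: setUS; rewrite subUset; split.
  exists (N `|` X); first by exists X.
  by rewrite setUACA setUid; apply: setUS; rewrite subUset; split.
rewrite /D /= FG; split; first exact: directed_bigcup_fully_invariant.
by move=> /(compact_directed cM G0 Gfi Gdir)[X /FD[]].
Qed.

Lemma max_fi_add_sub P A :
  max_fi M P -> fully_invariant A -> ~ A `<=` P -> add_sub P A = setT.
Proof.
move=> [fiP _ maxP] fiA AP.
have [PA|//] :=
  maxP _ (fully_invariant_add_sub fiP fiA) (sub_add_subl fiA.1).
by case: AP; rewrite -PA; exact: sub_add_subr fiP.1.
Qed.

End FullyInvariant.

(** * Submodules generated by the ambient module *)

Section Single.
Variables (R : pzRingType) (M : lmodType R) (X : eqType) (x : X).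

Fact single_finsupp (m : M) :
  (fun y => if y == x then m else 0) \in @finsupp_pred R M X.
Proof.
apply/asboolP; apply: (sub_finite_set _ (finite_set1 x)) => y /=.
by case: ifP => [/eqP //|_]; rewrite eqxx.
Qed.

Definition dsum_single (m : M) : dsum M X := Dsum (single_finsupp m).

Fact dsum_single_linear : linear dsum_single.
Proof.
move=> a m n; apply/val_inj/funext => y /=; rewrite !fctE.
by case: ifP => // _; rewrite scaler0 addr0.
Qed.

HB.instance Definition _ :=
  GRing.isLinear.Build R M (dsum M X) _ dsum_single dsum_single_linear.

End Single.

Section Generated.
Variables (R : pzRingType) (M : lmodType R).

(** A finitely supported family is the sum of its components, so the range of g
    is the sum of the ranges of its restrictions to the summands. *)
Lemma dsum_range_sub (X : eqType) (V : lmodType R)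
    (g : {linear dsum M X -> V}) (K : set V) :
  submodule K ->
  (forall f : {linear M -> V}, range f `<=` range g -> range f `<=` K) ->
  range g `<=` K.
Proof.
move=> subK gK _ [d _ <-]; have [K0 _] := (submoduleP K).1 subK.
have Kg x m : K (g (dsum_single x m)).
  apply: (gK (g \o dsum_single x)); last by exists m.
  by move=> _ [m' _ <-]; exists (dsum_single x m').
have /asboolP/finite_seqP[s ds] := valP d.
have {ds} : forall x, val d x != 0 -> x \in s.
  by move=> x dx; have : [set` s] x by rewrite -ds.
elim: s d => [|x s IHs] d ds.
  suff -> : d = 0 by rewrite linear0.
  by apply/val_inj/funext => y; have [|/ds] := eqVneq (val d y) 0.
rewrite -[d](subrK (dsum_single x (val d x))) linearD.
apply: submoduleD => //; apply: IHs => y /=; rewrite !fctE.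
have [->|yx] := eqVneq y x; first by rewrite subrr eqxx.
by rewrite subr0 => /ds; rewrite inE (negPf yx).
Qed.

(** A submodule N generated by M is the sum of the images of the maps from M
    to N, so an inclusion between submodules can be tested on such images. *)
Lemma generated_sub (N K : set M) : self_progenerator M ->
  submodule N -> submodule K ->
  (forall f : {linear M -> M}, range f `<=` N -> range f `<=` K) -> N `<=` K.
Proof.
move=> [_ gen] subN subK NK.
have [X [g gN]] := gen N subN; move: NK; rewrite -gN => NK.
(* X is an arbitrary type; its classical equality makes it an eqType. *)
exact: (@dsum_range_sub {classic X} M g K subK NK).
Qed.

End Generated.

(** * Frames of subsets and order isomorphisms *)

Section InclusionFrames.
Variables (T : Type) (F : set (set T)).

Definition incl_elt (A : set T) (FA : F A) : incl_poset F :=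
  exist (fun A : set T => A \in F) A (mem_set FA).

Lemma incl_posetE (x y : incl_poset F) : (x <= y)%O = (val x `<=` val y) :> Prop.
Proof. by rewrite leEsub subsetEset. Qed.

Lemma supremums_bigcup (S : set (incl_poset F)) (s : incl_poset F) :
  F (\bigcup_(x in S) val x) ->
  supremums S s <-> val s = \bigcup_(x in S) val x.
Proof.
move=> FS; split=> [[ub_s lub_s]|sE].
  apply/seteqP; split; last first.
    by apply: bigcup_sub => x /ub_s; rewrite /= incl_posetE.
  have := lub_s (incl_elt FS); rewrite /= incl_posetE.
  by apply=> x Sx; rewrite incl_posetE; exact: bigcup_sup.
split=> [x Sx|t ub_t]; rewrite incl_posetE sE; first exact: bigcup_sup.
by apply: bigcup_sub => x /ub_t; rewrite incl_posetE.
Qed.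

Lemma infimums_setI (x y m : incl_poset F) :
  F (val x `&` val y) -> infimums [set x; y] m <-> val m = val x `&` val y.
Proof.
move=> Fxy; split=> [[lb_m glb_m]|mE].
  apply/seteqP; split.
    by rewrite subsetI -!incl_posetE; split; apply: lb_m; [left | right].
  have := glb_m (incl_elt Fxy).
  rewrite /= incl_posetE; apply=> z /= [] ->; rewrite incl_posetE.
    exact: subIsetl.
  exact: subIsetr.
split=> [z /= [] ->|t lb_t]; rewrite incl_posetE mE.
- exact: subIsetl.
- exact: subIsetr.
- by rewrite subsetI -!incl_posetE; split; apply: lb_t; [left | right].
Qed.

(** Joins being unions and binary meets intersections, distributivity is that
    of sets; an arbitrary meet is the join of the lower bounds. *)
Lemma incl_poset_is_frame :
  (forall D : set (set T), D `<=` F -> F (\bigcup_(A in D) A)) ->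
  (forall A B, F A -> F B -> F (A `&` B)) ->
  is_frame (incl_poset F).
Proof.
move=> FU FI; have Fval (x : incl_poset F) : F (val x) by exact/set_mem/(valP x).
have FS (S : set (incl_poset F)) : F (\bigcup_(x in S) val x).
  rewrite -(bigcup_image S val id); apply: FU.
  by move=> _ [x _ <-].
have sup S : exists s : incl_poset F, supremums S s.
  by exists (incl_elt (FS S)); apply/supremums_bigcup.
split=> // [A _|x S s m].
  have [m [ub_m lub_m]] := sup (lbound A); exists m; split.
    by move=> x Ax; apply: lub_m => y; exact.
  by move=> y /ub_m.
move=> /(supremums_bigcup _ (FS S)) sE.
move=> /(infimums_setI _ (FI _ _ (Fval _) (Fval _))) mE.
apply/(supremums_bigcup _ (FS _)); rewrite mE sE setI_bigcupr.
apply/seteqP; split=> t [y].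
  move=> Sy xyt; have Fxy := FI _ _ (Fval x) (Fval y).
  exists (incl_elt Fxy) => //.
  by exists y => //; exact/infimums_setI.
move=> [z Sz /(infimums_setI _ (FI _ _ (Fval _) (Fval _))) ->] xzt.
by exists z.
Qed.

End InclusionFrames.

Section OrderIso.
Variables (d d' : Order.disp_t) (P : porderType d) (Q : porderType d').
Variables (f : P -> Q) (g : Q -> P).
Hypotheses (fK : cancel f g) (gK : cancel g f).
Hypothesis f_mono : {mono f : x y / (x <= y)%O}.

Lemma order_iso_ubound (S : set P) y : ubound (f @` S) y <-> ubound S (g y).
Proof.
split=> [ub x Sx|ub _ [x Sx <-]].
  by rewrite -f_mono gK; apply: ub; exists x.
by rewrite -[y]gK f_mono; exact: ub.
Qed.

Lemma order_iso_lbound (S : set P) y : lbound (f @` S) y <-> lbound S (g y).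
Proof.
split=> [lb x Sx|lb _ [x Sx <-]].
  by rewrite -f_mono gK; apply: lb; exists x.
by rewrite -[y]gK f_mono; exact: lb.
Qed.

Lemma order_iso_supremums (S : set P) s :
  supremums S s -> supremums (f @` S) (f s).
Proof.
move=> [ub lub]; split; first by apply/order_iso_ubound; rewrite fK.
by move=> y /order_iso_ubound/lub; rewrite -f_mono gK.
Qed.

Lemma order_iso_infimums (S : set P) m :
  infimums S m -> infimums (f @` S) (f m).
Proof.
move=> [lb glb]; split; first by apply/order_iso_lbound; rewrite fK.
by move=> y /order_iso_lbound/glb; rewrite -f_mono gK.
Qed.

Lemma order_iso_frame_hom : frame_hom f.
Proof.
by split=> [S s|A m _]; [exact: order_iso_supremums|exact: order_iso_infimums].
Qed.

End OrderIso.

Section FrameTransport.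
Variables (d d' : Order.disp_t) (P : porderType d) (Q : porderType d').

(** Distributivity is carried to Q by f, used there, and carried back by g. *)
Lemma order_iso_is_frame (f : P -> Q) (g : Q -> P) :
  cancel f g -> cancel g f -> {mono f : x y / (x <= y)%O} ->
  is_frame Q -> is_frame P.
Proof.
move=> fK gK f_mono [sup inf distr].
have g_mono : {mono g : x y / (x <= y)%O}.
  by move=> x y; rewrite -f_mono !gK.
have gfK (S : set P) : g @` (f @` S) = S.
  by rewrite image_comp (_ : g \o f = id) ?image_id //; exact: funext.
have f_inf := order_iso_infimums fK gK f_mono.
have g_inf := order_iso_infimums gK fK g_mono.
have f_sup := order_iso_supremums fK gK f_mono.
have g_sup := order_iso_supremums gK fK g_mono.
split=> [S|A finA|x S s m /f_sup sS /f_inf].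
- by have [s /g_sup] := sup (f @` S); rewrite gfK; exists (g s).
- have [m /g_inf] := inf _ (finite_image f finA).
  by rewrite gfK; exists (g m).
rewrite image_setU !image_set1 => mI.
have /g_sup := distr _ _ _ _ sS mI; rewrite fK; congr (supremums _ m).
apply/seteqP; split=> [_ [z [_ [y Sy <-] /g_inf zI] <-]|z [y Sy /f_inf]].
  by exists y => //; rewrite image_setU !image_set1 !fK in zI.
rewrite image_setU !image_set1 => zI.
by exists (f z) => //; exists (f y) => //; exists y.
Qed.

Lemma frame_isomorphic_of_mono_surj (f : P -> Q) :
  {mono f : x y / (x <= y)%O} -> is_surj f -> is_frame Q ->
  frame_isomorphic P Q.
Proof.
move=> f_mono /choice[g gK] frQ.
have fK : cancel f g.
  by move=> x; apply/le_anti; rewrite -!f_mono gK !lexx.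
have g_mono : {mono g : x y / (x <= y)%O}.
  by move=> x y; rewrite -f_mono !gK.
split; [exact: order_iso_is_frame fK gK f_mono frQ|by []|exists f, g].
by split=> //; [exact: order_iso_frame_hom gK _|exact: order_iso_frame_hom fK _].
Qed.

End FrameTransport.

(** * Pure parts and the maximal spectrum *)

Section PurePart.
Variables (R : pzRingType) (M : lmodType R).
Implicit Types (N K A B P : set M) (x y : M).

(** The name is that of the ring case: for M = R these are the x with
    K + l.ann(Rx) = R, the largest pure ideal inside K when R is strongly
    harmonic. *)
Definition pure_part K : set M :=
  [set x | add_sub K (Ann (cyclic_sub x)) = setT].

Definition max_open K : set (set_type (max_fi M)) :=
  [set P | ~ K `<=` val P].

(** Ann(B) is the largest submodule A with zero product A_M B. *)
Lemma mprod_eq0_sub_Ann A B : mprod A B = [set 0] -> A `<=` Ann B.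
Proof.
move=> AB0 x Ax f fB; suff: mprod A B (f x) by rewrite AB0.
exists [:: f x]; last by rewrite big_seq1.
by move=> y; rewrite inE => /eqP->; exists f => //; exists x.
Qed.

(** A is generated by M = K + B, and a map f from M to A sends K into K and B
    into the intersection of A and B; hence A, and with it M = K + A, lies in
    K + (A /\ B). *)
Lemma add_sub_setI K A B : self_progenerator M ->
  fully_invariant K -> fully_invariant A -> fully_invariant B ->
  add_sub K A = setT -> add_sub K B = setT -> add_sub K (A `&` B) = setT.
Proof.
move=> pM fiK fiA fiB KA KB; rewrite -subTset -{1}KA.
have fiI := fully_invariant_setI fiA fiB.
have [subS _] := fully_invariant_add_sub fiK fiI.
apply: add_sub_min => //; first exact: sub_add_subl fiI.1.
apply: (generated_sub pM fiA.1) => // f fA _ [m _ <-].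
have [k Kk [b Bb <-]] : add_sub K B m by rewrite KB.
rewrite linearD; exists (f k).
  by have /fully_invariantP[_] := fiK; apply.
exists (f b) => //; split; first by apply: fA; exists b.
by have /fully_invariantP[_] := fiB; apply.
Qed.

(** Otherwise P + A = P + B = M, and [add_sub_setI] would give P = M. *)
Lemma max_fi_prime P A B : self_progenerator M -> max_fi M P ->
  fully_invariant A -> fully_invariant B -> A `&` B `<=` P ->
  A `<=` P \/ B `<=` P.
Proof.
move=> pM mP fiA fiB ABP; have [fiP PT _] := mP.
have [AP|AP] := pselect (A `<=` P); first by left.
have [BP|BP] := pselect (B `<=` P); first by right.
case: PT; rewrite -subTset -(add_sub_setI pM fiP fiA fiB).
- by apply: add_sub_min => //; exact: fiP.1.
- exact: max_fi_add_sub.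
- exact: max_fi_add_sub.
Qed.

(** Sums and endomorphisms are both instances of a linear map from M x M to M.
    Scaling by an element of R is not linear over a noncommutative R; there
    R(ax) is contained in Rx, which enlarges the annihilator. *)
Lemma fully_invariant_pure_part K : self_progenerator M ->
  fully_invariant K -> fully_invariant (pure_part K).
Proof.
move=> pM fiK.
have pure_mono x y : Ann (cyclic_sub x) `<=` Ann (cyclic_sub y) ->
    pure_part K x -> pure_part K y.
  move=> xy Kx; rewrite /pure_part /= -subTset -Kx.
  by move=> _ [k Kk [a Aa <-]]; exists k => //; exists a => //; exact: xy.
have pure_lin (h : {linear (M * M)%type -> M}) x y :
    pure_part K x -> pure_part K y -> pure_part K (h (x, y)).
  move=> Kx Ky; have := Ann_cyclic_linear (h := h) (x := x) (y := y) pM.1.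
  set I := _ `&` _ => Ih; rewrite /pure_part /= -subTset.
  rewrite -(add_sub_setI pM fiK _ _ Kx Ky); try exact: fully_invariant_Ann.
  by move=> _ [k Kk [a Aa <-]]; exists k => //; exists a => //; exact: Ih.
apply/fully_invariantP; split=> [|f x Kx]; last exact: (pure_lin (f \o fst) x x).
apply/submoduleP; split=> [|a x y Kx Ky].
  rewrite /pure_part /= -subTset => m _; exists 0; first exact: submodule0 fiK.1.
  exists m; last exact: add0r.
  move=> f f0; have [|a _ /=] := f0 (f m); first by exists m.
  by rewrite scaler0 => <-.
apply: (pure_lin (fst \+ snd)) => //.
apply: (pure_mono x) => //; apply: subset_Ann => _ [b _ <-].
by exists (b * a) => //; rewrite scalerA.
Qed.

(** A map from M = K + Ann(Rx) to Rx sends K into K and kills Ann(Rx), and Rx is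
    generated by such maps. *)
Lemma pure_part_sub K : self_progenerator M ->
  fully_invariant K -> pure_part K `<=` K.
Proof.
move=> pM fiK x Kx.
suff: cyclic_sub x `<=` K by apply; exists 1; rewrite ?scale1r.
apply: (generated_sub pM (cyclic_submod_closed x) fiK.1) => f fx _ [m _ <-].
have [k Kk [a Aa <-]] : add_sub K (Ann (cyclic_sub x)) m by rewrite Kx.
rewrite linearD [f a]Aa // addr0.
by have /fully_invariantP[_] := fiK; apply.
Qed.

(** If L + Ann(Rx) were proper, a maximal P above it would contain L, hence K,
    hence K + Ann(Rx) = M. *)
Lemma pure_part_subset K L : fi_compact M ->
  fully_invariant K -> fully_invariant L ->
  max_open K `<=` max_open L -> pure_part K `<=` pure_part L.
Proof.
move=> cM fiK fiL KL x Kx; apply: contrapT => Lx.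
have fiA := fully_invariant_Ann (cyclic_sub x).
have [P mP LP] := sub_max_fi cM (fully_invariant_add_sub fiL fiA) Lx.
have [fiP PT _] := mP; apply: PT; rewrite -subTset -Kx.
apply: add_sub_min; first exact: fiP.1.
  apply: contrapT => KP.
  apply: (KL (exist _ P (mem_set mP) : set_type (max_fi M)) KP).
  by apply: subset_trans LP; exact: sub_add_subl fiA.1.
by apply: subset_trans LP; exact: sub_add_subr fiL.1.
Qed.

(** The pure part is large enough to avoid the same maximal submodules as K:
    this is where strong harmonicity enters, and where compactness replaces a
    union of submodules K + Ann(B) by a single one. *)
Lemma max_open_pure_part K : self_progenerator M -> strongly_harmonic M ->
  fi_compact M -> fully_invariant K -> max_open (pure_part K) = max_open K.
Proof.
move=> pM shM cM fiK; apply/seteqP; split=> -[P /[dup] /set_mem mP mP'] /= KP.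
  by move=> KP'; apply: KP; apply: subset_trans KP'; exact: pure_part_sub.
have {}KP : ~ K `<=` P by [].
have [fiP PT _] := mP.
pose D := [set add_sub K (Ann B) | B in
  [set B | fully_invariant B /\ ~ B `<=` P]].
have fiD B : fully_invariant (add_sub K (Ann B)).
  exact: fully_invariant_add_sub (fully_invariant_Ann B).
have D0 : D !=set0.
  exists (add_sub K (Ann setT)); exists setT => //.
  by split; [exact: fully_invariant_setT | rewrite subTset].
have Dfi : D `<=` fully_invariant (M:=M) by move=> _ [B _ <-].
have Ddir A B : D A -> D B -> exists2 C, D C & A `|` B `<=` C.
  move=> [A' [fiA' AP] <-] [B' [fiB' BP] <-].
  exists (add_sub K (Ann (A' `&` B'))).
    exists (A' `&` B') => //; split; first exact: fully_invariant_setI.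
    by move=> /(max_fi_prime pM mP fiA' fiB')[].
  have subS := (fiD (A' `&` B')).1; rewrite subUset; split;
    (apply: add_sub_min => //;
      [exact: sub_add_subl (fully_invariant_Ann _).1|];
      apply: subset_trans (sub_add_subr fiK.1); apply: subset_Ann).
  - exact: subIsetl.
  - exact: subIsetr.
have [|DT] := pselect (\bigcup_(A in D) A = setT).
  move=> /(compact_directed cM D0 Dfi Ddir)[B [fiB BP] KB] KP'.
  apply: BP; apply: subset_trans KP' => x Bx.
  rewrite /pure_part /= -subTset -KB; apply: add_sub_min.
  - exact: (fully_invariant_add_sub fiK (fully_invariant_Ann _)).1.
  - exact: sub_add_subl (fully_invariant_Ann _).1.
  apply: subset_trans (sub_add_subr fiK.1); apply: subset_Ann.
  by move=> _ [a _ <-]; exact: submoduleZ fiB.1 Bx.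
have [Q mQ DQ] :=
  sub_max_fi cM (directed_bigcup_fully_invariant D0 Dfi Ddir) DT.
have KQ B : fully_invariant B -> ~ B `<=` P -> add_sub K (Ann B) `<=` Q.
  move=> fiB BP; apply: subset_trans DQ => x ABx; exists (add_sub K (Ann B)) => //.
  by exists B.
have PQ : P <> Q.
  move=> PQ; apply: KP; rewrite PQ.
  apply: (subset_trans _ (KQ _ (@fully_invariant_setT R M) _)).
    exact: sub_add_subl (fully_invariant_Ann _).1.
  by rewrite subTset.
have [B [A [fiB fiA AQ BP AB0]]] := shM P Q mP mQ PQ.
case: AQ; apply: subset_trans (KQ B fiB BP).
by apply: subset_trans (sub_add_subr fiK.1); exact: mprod_eq0_sub_Ann.
Qed.

(** Binary intersections of open sets are open because the maximal submodules
    are prime. *)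
Lemma max_fi_open_is_frame : self_progenerator M ->
  is_frame (incl_poset (max_fi_open M)).
Proof.
move=> pM; apply: incl_poset_is_frame => [D DO|_ _ [A fiA ->] [B fiB ->]].
  (* The intersection of the points outside an open set is the largest K that
     defines it. *)
  exists (\bigcap_(P in ~` (\bigcup_(U in D) U)) val P).
    by apply: fully_invariant_bigcap => P _; have /set_mem[] := valP P.
  apply/seteqP; split=> P /=.
    move=> [U DU UP] KP; have [K fiK UE] := DO U DU.
    have := UP; rewrite UE; apply; apply: subset_trans KP => x Kx Q nQ.
    have [|KQ] := pselect (K `<=` val Q); first by apply.
    by case: nQ; exists U => //; rewrite UE.
  by move=> KP; apply: contrapT => nP; apply: KP => x; apply.
exists (A `&` B); first exact: fully_invariant_setI.
apply/seteqP; split=> P /=; have /set_mem mP := valP P.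
  by move=> [AP BP] /(max_fi_prime pM mP fiA fiB)[].
move=> ABP; split=> [AP|BP]; apply: ABP.
  by apply: subset_trans AP; exact: subIsetl.
by apply: subset_trans BP; exact: subIsetr.
Qed.

End PurePart.

Theorem corollary4p26 (R : pzRingType) (M : lmodType R)
    (hM : self_progenerator M)
    (hsh : strongly_harmonic M)
    (hcompact : fi_compact M) :
  frame_isomorphic (incl_poset (Psi M)) (incl_poset (max_fi_open M)).
Proof.
have PsiP (N : incl_poset (Psi M)) :
    fully_invariant (val N) /\ val N `<=` pure_part (val N).
  by have /set_mem[] := valP N.
have open_PsiP (N : incl_poset (Psi M)) : max_fi_open M (max_open (val N)).
  by exists (val N) => //; exact: (PsiP N).1.
pose f N : incl_poset (max_fi_open M) := incl_elt (open_PsiP N).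
apply: (frame_isomorphic_of_mono_surj (f := f)).
- move=> N K; have [fiN pN] := PsiP N; have [fiK _] := PsiP K.
  apply/idP/idP; rewrite !incl_posetE /=.
    move=> NK; apply: (subset_trans pN).
    by apply: subset_trans (pure_part_sub hM fiK); exact: pure_part_subset.
  by move=> NK P NP KP; apply: NP; exact: subset_trans KP.
- move=> U; have /set_mem[K fiK UE] := valP U.
  have fiP := fully_invariant_pure_part hM fiK.
  have PsiK : Psi M (pure_part K).
    by split=> //; apply: pure_part_subset => //; rewrite max_open_pure_part.
  exists (incl_elt PsiK); apply/val_inj => /=.
  by rewrite max_open_pure_part.
exact: max_fi_open_is_frame.
Qed.
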